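(* Let $\mathbb{Z}/2[t]$ be the polynomial ring over the field with two elements, and define $C_n\in\mathbb{Z}/2[t]$ for $n\ge 0$ by $C_0=0$, $C_1=1$, $C_2=t$, $C_3=t^2$ and $$C_{n+4}=C_{n+3}+(t^4+t^3+t^2+t)\,C_n+t^n(t^2+t)\qquad(n\ge 0).$$ Then for every integer $m\ge 0$, $C_{4m}$ is a $\mathbb{Z}/2$-linear combination of the $C_k$ with $k<4m$. *)

(* Defs.v *)
From mathcomp Require Import all_boot all_algebra.
Set Implicit Arguments.
Unset Strict Implicit.
Unset Printing Implicit Defensive.
Import GRing.Theory.
Local Open Scope ring_scope.

Fixpoint C (n : nat) : {poly 'F_2} :=
  match n with
  | 0 => 0
  | 1 => 1
  | 2 => 'X
  | 3 => 'X^2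
  | ((k.+1).+2 as k3).+1 =>
      C k3 + ('X^4 + 'X^3 + 'X^2 + 'X) * C k + 'X^k * ('X^2 + 'X)
  end.

Lemma C_rec (n : nat) :
  C n.+4 = C n.+3 + ('X^4 + 'X^3 + 'X^2 + 'X) * C n + 'X^n * ('X^2 + 'X).
Proof. by []. Qed.

(* Main.v *)
Require Import Defs.
From HB Require Import structures.
From mathcomp Require Import all_boot all_algebra.
From mathcomp Require Import ring zify.
Import GRing.Theory.
Local Open Scope ring_scope.

(** Let [T] be the linear map sending [t^n] to [C n], and put [S = t^2 + t],
    [s = t^4 + t^3], [f = s + S].  The recursion says [T (s p) = f T p + S p],
    and [S^4 = s S + s^2], whence [T (S^4 p) = f T (S p) + f^2 T p].
    Therefore [T (S^k) = (t + 1) b_k(f)], where [b_(2j+1)] is monic of degree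
    [j] and [b_(2j)] has degree less than [j].  So [b_(2m)] is a combination of
    the [b_(2i+1)] with [i < m], which yields a monic polynomial of degree
    [4m] in the kernel of [T]. *)

Definition T (p : {poly 'F_2}) : {poly 'F_2} := \sum_(i < size p) p`_i *: C i.

Lemma T_widen (n : nat) (p : {poly 'F_2}) :
  (size p <= n)%N -> T p = \sum_(i < n) p`_i *: C i.
Proof.
move=> le_pn; rewrite /T (big_ord_widen n (fun i => p`_i *: C i) le_pn).
rewrite big_mkcond; apply: eq_bigr => i _.
by case: ltnP => // le_pi; rewrite nth_default // scale0r.
Qed.

Lemma T_is_linear : linear T.
Proof.
move=> a p q; set n := maxn (size p) (size q).
have le_n : (size (a *: p + q)%R <= n)%N.
  apply: leq_trans (size_polyD _ _) _; rewrite geq_max leq_maxr andbT.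
  exact: leq_trans (size_scale_leq _ _) (leq_maxl _ _).
rewrite (T_widen _ _ le_n) (T_widen n p) ?leq_maxl // (T_widen n q) ?leq_maxr //.
rewrite scaler_sumr -big_split; apply: eq_bigr => i _ /=.
by rewrite coefD coefZ scalerDl scalerA.
Qed.

HB.instance Definition _ :=
  GRing.isLinear.Build 'F_2 {poly 'F_2} {poly 'F_2} _ T T_is_linear.

Lemma T_Xn (n : nat) : T 'X^n = C n.
Proof.
rewrite (T_widen n.+1) ?size_polyXn // big_ord_recr /= coefXn eqxx scale1r.
rewrite big1 ?add0r // => i _.
by rewrite coefXn ltn_eqF ?ltn_ord // scale0r.
Qed.

Lemma addpp (p : {poly 'F_2}) : p + p = 0.
Proof. by rewrite -mulr2n -scaler_nat (_ : 2%:R = 0) ?scale0r //; apply: val_inj. Qed.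

(** Carries characteristic 2 into [ring] proofs: the integer discrepancy between the two sides is
    supplied as an explicit multiple of 2. *)
Lemma mul2p (p : {poly 'F_2}) : 2 * p = 0.
Proof. by rewrite mulrDl mul1r addpp. Qed.

Local Notation S := ('X^2 + 'X : {poly 'F_2}).
Local Notation s := ('X^4 + 'X^3 : {poly 'F_2}).
Local Notation f := ('X^4 + 'X^3 + 'X^2 + 'X : {poly 'F_2}).

Lemma T_mul_s (p : {poly 'F_2}) : T (s * p) = f * T p + S * p.
Proof.
rewrite -[p]coefK poly_def.
elim/big_ind: _ => [|p1 p2 IH1 IH2|i _]; first by rewrite linear0 !mulr0 linear0 addr0.
  by rewrite linearD !mulrDr linearD /= IH1 IH2; ring.
rewrite linearZ -!scalerAr linearZ -scalerDr; congr (_ *: _) => /=.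
(* On ['X^i] the left side is [C i.+4 + C i.+3]; unfolding the recursion makes [C i.+3] appear
   twice, so it cancels. *)
rewrite mulrDl -!exprD linearD /= !T_Xn !addSn add0n C_rec.
by rewrite -[RHS]addr0 -(mul2p (C i.+3)); ring.
Qed.

Lemma T_mul_S4 (p : {poly 'F_2}) :
  T (S ^+ 4 * p) = f * T (S * p) + f ^+ 2 * T p.
Proof.
have -> : S ^+ 4 * p = s * (S * p) + s * (s * p).
  apply/eqP; rewrite -subr_eq0 -(mul2p (('X^7 + 2 * 'X^6 + 'X^5) * p)).
  by apply/eqP; ring.
rewrite linearD /= !T_mul_s.
(* The terms outside [T] are [S * (S * p) + S * (s * p) = S * (f * p)] and [f * (S * p)], which
   cancel. *)
rewrite -[RHS]addr0 -(mul2p (S * (f * p))).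
ring.
Qed.

Lemma T_S_pow_rec (k : nat) :
  T (S ^+ k.+4) = f * T (S ^+ k.+1) + f ^+ 2 * T (S ^+ k).
Proof. by rewrite -[k.+4]add4n exprD T_mul_S4 -exprS. Qed.

(** With ['X] standing for [f], [T_S_pow_rec] reads b_(k+4) = X b_(k+1) + X^2 b_k. It mixes
    parities, so both are treated in one induction, with [j = 0] and [j = 1] as base cases. *)
Lemma T_S_pow_even_odd (j : nat) :
  (exists2 b : {poly 'F_2}, T (S ^+ (2 * j)) = ('X + 1) * (b \Po f) & (size b <= j)%N)
  /\ (exists2 b : {poly 'F_2}, T (S ^+ (2 * j).+1) = ('X + 1) * (b \Po f)
       & b \is monic /\ size b = j.+1).
Proof.
have C4E : C 4 = 'X.
  by rewrite C_rec /= mulr0 addr0 expr0 mul1r addrA addpp add0r.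
elim/ltn_ind: j => -[|[|j]] IH.
- split; first by exists 0; rewrite ?size_poly0 // comp_poly0 mulr0 expr0 (T_Xn 0).
  exists 1; last by rewrite monic1 size_poly1.
  rewrite -polyC1 comp_polyC mulr1 expr1 linearD /=.
  by rewrite (T_Xn 2) (T_Xn 1).
- split.
    exists 0; rewrite ?size_poly0 // comp_poly0 mulr0.
    have -> : S ^+ (2 * 1) = 'X^4 + 'X^2.
      by rewrite -[RHS]addr0 -(mul2p 'X^3); ring.
    by rewrite linearD /= !T_Xn C4E addpp.
  exists 'X; last by rewrite monicX size_polyX.
  rewrite comp_polyX.
  have -> : S ^+ (2 * 1).+1 = s * (1 + 'X^2) + 2 * 'X^5 + 2 * 'X^4 by ring.
  (* Here [T (1 + 'X^2) = 'X] and [S * (1 + 'X^2) = f], so the value is [f * 'X + f]. *)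
  rewrite !mul2p !addr0 T_mul_s linearD /= (T_Xn 0) (T_Xn 2) /=.
  by ring.
have [|[b0 Eb0 sz_b0] [b1 Eb1 [mon_b1 sz_b1]]] := IH j; first by lia.
have [|[b2 Eb2 sz_b2] _] := IH j.+1; first by lia.
split.
  exists ('X * b1 + 'X^2 * b0).
    have -> : (2 * j.+2 = (2 * j).+4)%N by lia.
    rewrite T_S_pow_rec Eb1 Eb0 rmorphD !rmorphM /= comp_polyX.
    by ring.
  apply: leq_trans (size_polyD _ _) _; rewrite geq_max; apply/andP; split.
    by rewrite mulrC size_mulX ?monic_neq0 // sz_b1.
  by apply: leq_trans (size_polyMleq _ _) _; rewrite size_polyXn; lia.
(* At odd indices the term from the previous odd polynomial strictly dominates, which keeps the sum
   monic. *)
have sz_lt : (size ('X * b2)%R < size ('X^2 * b1)%R)%N.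
  rewrite [X in (_ < X)%N]size_monicM ?monicXn ?monic_neq0 // size_polyXn sz_b1.
  by apply: leq_ltn_trans (size_polyMleq _ _) _; rewrite size_polyX; lia.
exists ('X^2 * b1 + 'X * b2).
  have -> : ((2 * j.+2).+1 = (2 * j).+1.+4)%N by lia.
  rewrite T_S_pow_rec Eb1 (_ : (2 * j).+2 = 2 * j.+1)%N; last by lia.
  rewrite Eb2 rmorphD !rmorphM /= comp_polyX.
  by ring.
split; first by rewrite monicE lead_coefDl // -monicE monicMl ?monicXn.
rewrite size_polyDl // size_monicM ?monicXn ?monic_neq0 // size_polyXn sz_b1.
by lia.
Qed.

Lemma monic_S : S \is monic.
Proof. by rewrite monicE lead_coefDl ?lead_coefXn // size_polyX size_polyXn. Qed.

Lemma size_S_pow (k : nat) : size (S ^+ k) = (2 * k).+1.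
Proof.
have sz_S : size S = 3 by rewrite size_polyDl ?size_polyXn // size_polyX.
have nz_Sk : S ^+ k != 0 by rewrite monic_neq0 ?monic_exp ?monic_S.
by rewrite -[LHS]prednK ?size_poly_gt0 // size_exp sz_S.
Qed.

(** Triangular elimination: the odd-index polynomials are monic of degrees 0, ..., j-1. The largest
    power of [S] used is 2j-1, of size 4j-1; this gives the bound. *)
Lemma T_surj_small (j : nat) (q : {poly 'F_2}) : (size q <= j)%N ->
  exists2 Q : {poly 'F_2}, T Q = ('X + 1) * (q \Po f) & (size Q <= (4 * j).-1)%N.
Proof.
elim: j q => [|j IH] q sz_q.
  exists 0; last by rewrite size_poly0.
  by move: sz_q; rewrite leqn0 size_poly_eq0 => /eqP->; rewrite linear0 comp_poly0 mulr0.
have [_ [b Eb [mon_b sz_b]]] := T_S_pow_even_odd j.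
have [|Q EQ sz_Q] := IH (q - q`_j *: b).
  apply/leq_sizeP => i; rewrite leq_eqVlt coefB coefZ => /orP[/eqP <-|lt_ji].
    by move: mon_b; rewrite monicE lead_coefE sz_b => /eqP->; rewrite mulr1 subrr.
  rewrite [q`_i]nth_default ?(leq_trans sz_q) //.
  by rewrite [b`_i]nth_default ?sz_b // mulr0 subrr.
exists (Q + q`_j *: S ^+ (2 * j).+1).
  rewrite linearD linearZ /= EQ Eb linearB linearZ /= mulrBr.
  by rewrite -scalerAr subrK.
apply: leq_trans (size_polyD _ _) _; rewrite geq_max; apply/andP; split.
  by apply: leq_trans sz_Q _; lia.
by apply: leq_trans (size_scale_leq _ _) _; rewrite size_S_pow; lia.
Qed.

Theorem theorem2p10 (m : nat) :
  exists c : 'I_(4 * m) -> 'F_2, C (4 * m) = \sum_(k < 4 * m) c k *: C k.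
Proof.
have [[b Eb sz_b] _] := T_S_pow_even_odd m.
have [Q EQ sz_Q] := T_surj_small _ _ sz_b.
have sz_S : size (S ^+ (2 * m)) = (4 * m).+1 by rewrite size_S_pow; lia.
have lead_S : (S ^+ (2 * m))`_(4 * m) = 1.
  by have /monicP := monic_exp (2 * m) monic_S; rewrite lead_coefE sz_S.
have sz_Q' : (size Q <= 4 * m)%N by lia.
(* [Q] has no term of degree [4 * m], so this kernel element of [T] has top coefficient -1, and
   solving for [C (4 * m)] leaves the lower coefficients unchanged. *)
exists (fun k => (Q - S ^+ (2 * m))`_k).
have : T (Q - S ^+ (2 * m)) = 0 by rewrite linearB /= EQ Eb subrr.
rewrite (T_widen (4 * m).+1); last first.
  apply: leq_trans (size_polyD _ _) _; rewrite size_polyN sz_S geq_max leqnn andbT.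
  by lia.
rewrite big_ord_recr /= [in X in _ + X]coefB lead_S nth_default // sub0r scaleN1r.
by move/eqP; rewrite subr_eq0 => /eqP->.
Qed.
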